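(* Fix integers $1\le t<k$ and $\lambda\ge 1$, and let $r=r(n)$ be arbitrary. Let $\mathcal{C}\subseteq\binom{[n]}{k}$ be a random family in which each $k$-subset of $[n]$ is included independently with probability \[ p=\frac{1}{\binom{n-t}{k-t}}\left(\ln\binom{n}{t}+(\lambda-1)\ln\ln\binom{n}{t}+r\right). \] Let $X$ denote the number of $t$-subsets of $[n]$ that are contained in at most $\lambda-1$ members of $\mathcal{C}$. Then, as $n\to\infty$, \[ r\to+\infty\Rightarrow \mathbb{P}(X=0)\to 1,\qquad r\to-\infty\Rightarrow \mathbb{P}(X=0)\to 0. \]
   Context: $\binom{[n]}{k}$ denotes the family of $k$-element subsets of $[n]=\{1,\dots,n\}$. *)

(* Defs.v *)
From HB Require Import structures.
From mathcomp Require Import all_boot all_order all_algebra.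
From mathcomp Require Import all_classical all_reals all_analysis.

Set Implicit Arguments.
Unset Strict Implicit.
Unset Printing Implicit Defensive.

Import Order.TTheory GRing.Theory Num.Theory numFieldNormedType.Exports.

Local Open Scope classical_set_scope.
Local Open Scope ring_scope.

(* The ground set [n] is encoded by 'I_n. *)
Definition ksubsets (n k : nat) : {set {set 'I_n}} :=
  [set A : {set 'I_n} | #|A| == k]%SET.

Definition mutually_independent d (T : measurableType d) (R : realType)
    (P : probability T R) (I : finType) (D : {set I}) (E : I -> set T) : Prop :=
  forall J : {set I}, J \subset D ->
    P (\bigcap_(i in [set` J]) E i) = (\prod_(i in J) P (E i))%E.

(* The events {A \in C}, for A ranging over the k-subsets, are mutually
   independent and each has probability p; in particular, when k <= n, this
   forces p to lie in [0, 1]. *)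
Definition binomial_random_family d (T : measurableType d) (R : realType)
    (P : probability T R) (n k : nat) (p : R) (C : T -> {set {set 'I_n}}) : Prop :=
  [/\ forall w, C w \subset ksubsets n k,
      forall A, A \in ksubsets n k -> measurable [set w | A \in C w],
      forall A, A \in ksubsets n k -> P [set w | A \in C w] = p%:E
    & mutually_independent P (ksubsets n k) (fun A => [set w | A \in C w])].

(* ln x = 0 for x <= 0, so this is the intended value only for n large. *)
Definition inclusion_prob (R : realType) (t k lambda n : nat) (r : R) : R :=
  ('C(n - t, k - t)%:R)^-1 *
  (ln 'C(n, t)%:R + (lambda%:R - 1) * ln (ln 'C(n, t)%:R) + r).

Definition num_undercovered (n t lambda : nat) (F : {set {set 'I_n}}) : nat :=
  #|[set S in ksubsets n t |
      (#|[set A in F | S \subset A]%SET| <= lambda - 1)%N]%SET|.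

(* Main.v *)
Require Import Defs.
From mathcomp Require Import all_boot all_order all_algebra.
From mathcomp Require Import lra ring zify.

Import Order.TTheory GRing.Theory Num.Theory.
Local Open Scope ring_scope.

(** Write [l = lambda - 1], [N = 'C(n - t, k - t)], [L = ln 'C(n, t)] and
    [mu = N p = L + l ln L + r]; each [t]-set has degree [Bin(N, p)] in the
    random family, so [E X = e^L P(Bin(N, p) <= l)].
    If [r -> +oo], Markov's inequality for [mu ^- Bin(N, p)] gives
    [P(Bin(N, p) <= l) <= e mu^l e^-mu], hence [E X = O(e^(-r/2))].
    If [r -> -oo], Chebyshev's inequality applies.  For two [t]-sets [S <> S'],
    deleting the at most [N' = 'C(n - t - 1, k - t - 1)] blocks through both
    leaves two independent degrees, and
    [P(Bin(N - m, p) <= l) <= (1 - p)^-m P(Bin(N, p) <= l)]; thus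
    [E X^2 <= E X + (1 - N' p)^-2 (E X)^2].  Here [N' p -> 0] since
    [N' p = mu (k - t) / (n - t)], and [E X -> oo] because
    [E X >= c min(e^(L/2), e^-r)]. *)

(** * Random subsets with independent elements, and binomial tails *)

Section BernoulliSubset.
Set Implicit Arguments.
Unset Strict Implicit.

Variables (R : realFieldType) (p : R).

Definition binom_mass (N j : nat) : R := 'C(N, j)%:R * p ^+ j * (1 - p) ^+ (N - j).

(** The range may exceed [N]: for [j > N] the factor ['C(N, j)] vanishes, so the truncated
    difference [N - j] does no harm. *)
Definition binom_cdf (N l : nat) : R := \sum_(j < l.+1) binom_mass N j.

Variable T : finType.
Implicit Types (D F G H : {set T}) (f g : {set T} -> R).

(** The probability that a random subset of [D], taking each element independently with probability
    [p], equals [F]. Probability is thus handled as finite sums until the law of the family is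
    computed. *)
Definition weight D F : R := p ^+ #|F| * (1 - p) ^+ #|D :\: F|.

Definition expect D f : R := \sum_(F : {set T} | F \subset D) weight D F * f F.

Lemma eq_expect D f g : {in powerset D, f =1 g} -> expect D f = expect D g.
Proof.
move=> fg; apply: eq_bigr => F FD; rewrite fg//.
by rewrite inE.
Qed.

(** Independence over disjoint sets: [F] is determined by the pair of its traces on [G] and [H], and
    the weight is the product of the weights of the traces. *)
Lemma expect_setU G H f g : [disjoint G & H] ->
  expect (G :|: H) (fun F => f (F :&: G) * g (F :&: H)) = expect G f * expect H g.
Proof.
move=> dGH; rewrite /expect big_distrlr /= pair_big /=.
have GH0 : G :&: H = set0 by apply/eqP; rewrite setI_eq0.
rewrite (reindex_onto (fun u : {set T} * {set T} => u.1 :|: u.2)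
  (fun F => (F :&: G, F :&: H))) /=; last first.
  by move=> F FD; rewrite -setIUr; apply/setIidPl.
apply: eq_big => [[A B]|[A B]] /=.
  apply/andP/andP => [[ABD /eqP[<- <-]]|[AG BH]]; first by rewrite !subsetIr.
  split; first exact: setUSS.
  have AH0 : A :&: H = set0.
    by apply/eqP; rewrite -subset0 -GH0; apply: setSI.
  have BG0 : B :&: G = set0.
    by apply/eqP; rewrite -subset0 -GH0 setIC; apply: setIS.
  rewrite !setIUl AH0 BG0 setU0 set0U.
  by rewrite (setIidPl AG) (setIidPl BH).
move=> /andP[ABD /eqP[AE BE]]; rewrite AE BE.
have AG : A \subset G by rewrite -AE subsetIr.
have BH : B \subset H by rewrite -BE subsetIr.
rewrite [RHS]mulrACA; congr (_ * _).
rewrite /weight [RHS]mulrACA -!exprD.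
have disj (U V : {set T}) : U \subset G -> V \subset H -> #|U :|: V| = (#|U| + #|V|)%N.
  move=> UG VH; rewrite cardsU (_ : U :&: V = set0) ?cards0 ?subn0//.
  by apply/eqP; rewrite -subset0 -GH0; apply: setISS.
rewrite disj//; congr (_ * _ ^+ _).
rewrite -disj ?subsetDl//; congr (#|pred_of_set _|).
apply/setP => x; rewrite !inE.
have xGH : ~~ ((x \in G) && (x \in H)) by have := in_set0 x; rewrite -GH0 inE => ->.
have /implyP := subsetP AG x; have /implyP := subsetP BH x; move: xGH.
by case: (x \in G); case: (x \in H); case: (x \in A); case: (x \in B).
Qed.

(** Grouping the subsets of [D] by size shows that the size is binomial. *)
Lemma expect_card D (f : nat -> R) :
  expect D (fun F => f #|F|) = \sum_(j < #|D|.+1) binom_mass #|D| j * f j.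
Proof.
rewrite /expect (partition_big (fun F : {set T} => inord #|F| : 'I_#|D|.+1) predT) //=.
apply: eq_bigr => j _.
rewrite (eq_bigr (fun=> p ^+ j * (1 - p) ^+ (#|D| - j) * f j)); last first.
  move=> F /andP[FD /eqP Fj].
  have cF : #|F| = j by rewrite -Fj inordK// ltnS subset_leq_card.
  by rewrite /weight cardsD (setIidPr FD) cF.
rewrite sumr_const -[in LHS]mulr_natl /binom_mass !mulrA; congr (_%:R * _ * _ * _).
rewrite -(cards_draws D j); apply: eq_card => F; rewrite !inE /in_mem/=.
case FD: (F \subset D) => //=.
by rewrite -val_eqE/= inordK// ltnS subset_leq_card.
Qed.

Lemma sum_binom_mass N : \sum_(j < N.+1) binom_mass N j = 1.
Proof.
rewrite -[RHS](expr1n _ N) -[in RHS](subrK p 1) exprDn.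
apply: eq_bigr => j _; rewrite /binom_mass -mulr_natl; ring.
Qed.

Lemma expect1 D : expect D (fun=> 1) = 1.
Proof.
rewrite (expect_card D (fun=> 1)) -[RHS](sum_binom_mass #|D|).
by apply: eq_bigr => j _; rewrite mulr1.
Qed.

Lemma binom_cdfE N l :
  \sum_(j < N.+1) binom_mass N j * (j <= l)%N%:R = binom_cdf N l.
Proof.
rewrite /binom_cdf.
rewrite -(big_mkord predT (fun j => binom_mass N j * (j <= l)%N%:R)).
rewrite -(big_mkord predT (binom_mass N)).
have mass0 j : (N < j)%N -> binom_mass N j = 0.
  by move=> Nj; rewrite /binom_mass bin_small// !mul0r.
(* Both sums are extended to a common range, on which they agree term by term. *)
rewrite (big_nat_widen _ _ (maxn N.+1 l.+1)) ?leq_maxl//.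
rewrite [RHS](big_nat_widen _ _ (maxn N.+1 l.+1)) ?leq_maxr//.
rewrite big_mkcond [RHS]big_mkcond; apply: eq_bigr => j _ /=.
rewrite !ltnS; case: (leqP j N) => jN; case: (leqP j l) => jl //=;
  rewrite ?mulr1 ?mulr0// mass0//.
Qed.

(** The trace on [G] is again a random subset with parameter [p]: the elements of [D :\: G]
    contribute a factor of total weight 1. *)
Lemma expect_restrict D G f : G \subset D ->
  expect D (fun F => f (F :&: G)) = expect G f.
Proof.
move=> GD; rewrite -[RHS]mulr1 -(expect1 (D :\: G)) -expect_setU; last first.
  by rewrite -setI_eq0 setIDA setDIl setDv set0I.
rewrite (_ : G :|: D :\: G = D).
  by apply: eq_expect => F _; rewrite mulr1.
by rewrite -{1}(setIidPr GD) setID.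
Qed.

Lemma expect_card_le D G l : G \subset D ->
  expect D (fun F => (#|F :&: G| <= l)%N%:R) = binom_cdf #|G| l.
Proof.
move=> GD; rewrite (expect_restrict (fun F => (#|F| <= l)%N%:R) GD).
by rewrite (expect_card G (fun j => (j <= l)%N%:R)) binom_cdfE.
Qed.

Lemma expect_card_le2 D G H l : G \subset D -> H \subset D -> [disjoint G & H] ->
  expect D (fun F => (#|F :&: G| <= l)%N%:R * (#|F :&: H| <= l)%N%:R) =
  binom_cdf #|G| l * binom_cdf #|H| l.
Proof.
move=> GD HD dGH.
rewrite -(expect_card_le l (subxx G)) -(expect_card_le l (subxx H)) -expect_setU //.
have GHD : G :|: H \subset D by rewrite subUset GD.
rewrite -(expect_restrict _ GHD); apply: eq_expect => F _.
rewrite /= -!setIA.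
by rewrite !setIid (setIidPr (subsetUl _ _)) (setIidPr (subsetUr _ _)).
Qed.

Lemma expect_sum D (I : finType) (J : {set I}) (f : I -> {set T} -> R) :
  expect D (fun F => \sum_(i in J) f i F) = \sum_(i in J) expect D (f i).
Proof.
rewrite /expect exchange_big /=; apply: eq_bigr => F _.
by rewrite big_distrr.
Qed.

Lemma expectZ D a f : expect D (fun F => a * f F) = a * expect D f.
Proof. by rewrite /expect big_distrr; apply: eq_bigr => F _; rewrite mulrCA. Qed.

Lemma expectD D f g : expect D (fun F => f F + g F) = expect D f + expect D g.
Proof. by rewrite /expect -big_split; apply: eq_bigr => F _; rewrite mulrDr. Qed.

Hypothesis p01 : 0 <= p <= 1.

Lemma le_expect D f g : (forall F, F \subset D -> f F <= g F) ->
  expect D f <= expect D g.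
Proof.
case/andP: p01 => p0 p1 fg; apply: ler_sum => F FD.
by apply: ler_wpM2l; [rewrite mulr_ge0// exprn_ge0// subr_ge0 | exact: fg].
Qed.

Lemma expect_ge0 D f : (forall F, 0 <= f F) -> 0 <= expect D f.
Proof.
case/andP: p01 => p0 p1 f0; apply: sumr_ge0 => F _.
by rewrite !mulr_ge0 ?exprn_ge0 ?subr_ge0.
Qed.

Lemma binom_mass_ge0 N j : 0 <= binom_mass N j.
Proof.
by case/andP: p01 => p0 p1; rewrite !mulr_ge0 ?exprn_ge0// subr_ge0.
Qed.

Lemma binom_cdf_ge0 N l : 0 <= binom_cdf N l.
Proof. by apply: sumr_ge0 => j _; exact: binom_mass_ge0. Qed.

(** At most [l] successes occur in [N] trials if [m] of the trials fail and the other [N - m] have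
    at most [l] successes. The comparison is termwise, by ['C(N - m, j) <= 'C(N, j)]. *)
Lemma ler_binom_cdf_subn N m l : (m <= N)%N ->
  (1 - p) ^+ m * binom_cdf (N - m) l <= binom_cdf N l.
Proof.
case/andP: p01 => p0 p1 mN; have q0 : 0 <= 1 - p by rewrite subr_ge0.
rewrite /binom_cdf big_distrr /=; apply: ler_sum => j _.
case: (leqP j (N - m)) => jN; last first.
  by rewrite /binom_mass bin_small// !mul0r mulr0 -/(binom_mass N j) binom_mass_ge0.
rewrite /binom_mass.
have -> : (N - j = m + (N - m - j))%N by lia.
rewrite exprD mulrCA.
apply: ler_wpM2r; first by rewrite mulr_ge0// exprn_ge0.
apply: ler_wpM2r; first exact: exprn_ge0.
by rewrite ler_nat leq_bin2l// leq_subr.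
Qed.

(* Markov's inequality for [s ^ Bin(N, p)]. *)
Lemma binom_cdf_chernoff N l (s : R) : 0 < s <= 1 ->
  s ^+ l * binom_cdf N l <= (1 - p + p * s) ^+ N.
Proof.
case/andP: p01 => p0 p1 /andP[s0 s1].
(* The right-hand side is the generating function of Bin(N, p) at [s], expanded by the binomial
   theorem. *)
rewrite -binom_cdfE exprDn big_distrr /=; apply: ler_sum => j _.
rewrite -[leRHS]mulr_natl exprMn.
have -> : 'C(N, j)%:R * ((1 - p) ^+ (N - j) * (p ^+ j * s ^+ j)) =
  binom_mass N j * s ^+ j by rewrite /binom_mass; ring.
rewrite mulrCA; apply: ler_wpM2l; first exact: binom_mass_ge0.
case: leqP => jl; last by rewrite mulr0 exprn_ge0// ltW.
by rewrite mulr1; apply: ler_wiXn2l => //; exact: ltW.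
Qed.

End BernoulliSubset.

(** * First and second moments of the number of undercovered sets *)

Section Undercovered.
Set Implicit Arguments.
Unset Strict Implicit.
Variables (R : realFieldType) (p : R) (n k t l : nat).
Hypotheses (p01 : 0 <= p <= 1) (tk : (t < k)%N).
Implicit Types (S : {set 'I_n}) (F : {set {set 'I_n}}).

(** The possible blocks through [S]; the degree of [S] in [F] is [#|F :&: star S|]. *)
Definition star S : {set {set 'I_n}} := [set A in ksubsets n k | S \subset A].

Lemma star_sub S : star S \subset ksubsets n k.
Proof. by apply/subsetP => A; rewrite inE => /andP[]. Qed.

Lemma card_star S : (#|S| <= k)%N -> #|star S| = 'C(n - #|S|, k - #|S|).
Proof.
move=> Sk; have -> : (n - #|S|)%N = #|~: S| by rewrite [RHS]cardsCs setCK card_ord.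
rewrite -cards_draws.
have dSB (B : {set 'I_n}) : B \subset ~: S -> S :&: B = set0.
  by rewrite -disjoints_subset -setI_eq0 setIC => /eqP.
rewrite -(card_in_imset (f := setU S)); last first.
  move=> B1 B2; rewrite !inE => /andP[B1S _] /andP[B2S _] E.
  have := congr1 (fun X => X :\: S) E.
  rewrite !setDUl setDv !set0U !setDE.
  by rewrite (setIidPl B1S) (setIidPl B2S).
apply: eq_card => A; rewrite !inE; apply/andP/imsetP => [[/eqP Ak SA]|[B]].
  exists (A :\: S); last by rewrite -{1}(setIidPr SA) setID.
  by rewrite !inE cardsD (setIidPr SA) Ak eqxx andbT setDE subsetIr.
rewrite !inE => /andP[BS /eqP Bk] ->; split; last exact: subsetUl.
by rewrite cardsU dSB// cards0 subn0 Bk subnKC.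
Qed.

Definition under S F : bool := (#|F :&: star S| <= l)%N.

Lemma num_undercoveredE F : F \subset ksubsets n k ->
  (num_undercovered t l.+1 F)%:R = \sum_(S in ksubsets n t) (under S F)%:R :> R.
Proof.
move=> FD.
have FS S : [set A in F | S \subset A] = F :&: star S.
  apply/setP => A; rewrite !inE; case FA: (A \in F) => //=.
  by have := subsetP FD A FA; rewrite inE => ->.
rewrite /num_undercovered -sum1_card natr_sum.
rewrite [LHS]big_mkcond [RHS]big_mkcond /=; apply: eq_bigr => S _.
by rewrite !inE FS subn1 /under; case: (#|S| == t) => //=; case: ifP.
Qed.

Let N := 'C(n - t, k - t).
Let N' := 'C(n - t.+1, k - t.+1).
Let b := binom_cdf p N l.

Lemma expect_under S : S \in ksubsets n t ->
  expect p (ksubsets n k) (fun F => (under S F)%:R) = b.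
Proof.
rewrite inE => /eqP St.
by rewrite (expect_card_le p l (star_sub S)) card_star St ?(ltnW tk).
Qed.

(* The stars of two distinct [t]-sets meet in at most [N'] blocks; outside
   their intersection the two degrees are independent. *)
Lemma expect_under2 S S' : S \in ksubsets n t -> S' \in ksubsets n t -> S != S' ->
  (1 - p) ^+ (N'.*2) *
  expect p (ksubsets n k) (fun F => (under S F)%:R * (under S' F)%:R) <= b ^+ 2.
Proof.
case/andP: (p01) => p0 p1; have q0 : 0 <= 1 - p by rewrite subr_ge0.
rewrite !inE => /eqP St /eqP S't neq.
have [x xS' xS] : exists2 x, x \in S' & x \notin S.
  apply/subsetPn; apply: contra neq => S'S.
  by rewrite eq_sym eqEcard S'S St S't leqnn.
have cS : #|star S| = N by rewrite card_star St// ltnW.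
have cS' : #|star S'| = N by rewrite card_star S't// ltnW.
set m := #|star S :&: star S'|.
have mN' : (m <= N')%N.
  (* A block through both [S] and [S'] contains the set [x |: S] of size [t.+1]. *)
  have <- : #|star (x |: S)| = N'.
    by rewrite card_star cardsU1 xS St// addnC addn1.
  apply: subset_leq_card; apply/subsetP => A; rewrite !inE.
  move=> /andP[/andP[-> SA] /andP[_ S'A]] /=.
  by rewrite subUset SA sub1set (subsetP S'A).
have mN : (m <= N)%N by rewrite -cS subset_leq_card// subsetIl.
set G := star S :\: star S'; set G' := star S' :\: star S.
have cG : #|G| = (N - m)%N by rewrite cardsD cS.
have cG' : #|G'| = (N - m)%N by rewrite cardsD cS' setIC.
have GD : G \subset ksubsets n k.
  exact: fintype.subset_trans (subsetDl _ _) (star_sub S).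
have G'D : G' \subset ksubsets n k.
  exact: fintype.subset_trans (subsetDl _ _) (star_sub S').
have dGG' : [disjoint G & G'].
  rewrite -setI_eq0 -subset0; apply/subsetP => A; rewrite !inE.
  by case: (#|A| == k) => //=; case: (S \subset A); rewrite ?andbF.
(* Discarding the common blocks lowers both degrees, so the joint event only grows; on the disjoint
   [G] and [G'] it factorises. *)
have le1 : expect p (ksubsets n k) (fun F => (under S F)%:R * (under S' F)%:R)
    <= binom_cdf p (N - m) l ^+ 2.
  rewrite expr2 -{1}cG -cG' -(expect_card_le2 p l GD G'D dGG').
  apply: le_expect => // F _; rewrite -!natrM ler_nat !mulnb.
  case/boolP: (under S F && under S' F) => // /andP[uS uS'].
  rewrite lt0b; apply/andP; split.
    apply: leq_trans uS; apply: subset_leq_card; apply: setIS; exact: subsetDl.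
  apply: leq_trans uS'; apply: subset_leq_card; apply: setIS; exact: subsetDl.
apply: le_trans (ler_wpM2l (exprn_ge0 _ q0) le1) _.
(* The exponent [N'.*2] supplies one factor [(1 - p) ^+ N'] to each of the two tails. *)
rewrite -muln2 exprM -exprMn lerXn2r ?nnegrE ?mulr_ge0 ?exprn_ge0 ?binom_cdf_ge0//.
apply: le_trans (ler_binom_cdf_subn p01 l mN).
apply: ler_wpM2r; first exact: binom_cdf_ge0.
by apply: ler_wiXn2l => //; rewrite gerBl.
Qed.

Let M := 'C(n, t).

Lemma card_ksubsets : #|ksubsets n t| = M.
Proof. by rewrite card_draws card_ord. Qed.

Lemma expect_num_undercovered :
  expect p (ksubsets n k) (fun F => (num_undercovered t l.+1 F)%:R) = M%:R * b.
Proof.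
rewrite (eq_expect p (g := fun F => \sum_(S in ksubsets n t) (under S F)%:R)).
  rewrite expect_sum (eq_bigr (fun=> b)) => [|S]; last exact: expect_under.
  by rewrite sumr_const card_ksubsets mulr_natl.
by move=> F; rewrite inE; exact: num_undercoveredE.
Qed.

(** Markov's inequality, in the pointwise form [1 <= X + [X = 0]]. *)
Lemma first_moment :
  1 - M%:R * b <=
  expect p (ksubsets n k) (fun F => (num_undercovered t l.+1 F == 0)%N%:R).
Proof.
rewrite lerBlDr -expect_num_undercovered -expectD -[leLHS](expect1 p (ksubsets n k)).
by apply: le_expect => // F _; rewrite -natrD ler1n; case: num_undercovered.
Qed.

(** Chebyshev's inequality, from the pointwise bound [m ^+ 2 * [X = 0] <= (X - m) ^+ 2] with mean
    [m = M%:R * b]. The number [c^-1] bounds the correlation factor of two distinct sets. *)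
Lemma second_moment (c : R) : 0 < c <= (1 - p) ^+ N'.*2 ->
  (M%:R * b) ^+ 2 *
    expect p (ksubsets n k) (fun F => (num_undercovered t l.+1 F == 0)%N%:R) <=
  M%:R * b + (c^-1 - 1) * (M%:R * b) ^+ 2.
Proof.
move=> /andP[c0 cq].
set X := fun F => (num_undercovered t l.+1 F)%:R : R.
have b0 : 0 <= b := binom_cdf_ge0 p01 N l.
have X2 : expect p (ksubsets n k) (fun F => X F ^+ 2) <=
    M%:R * b + c^-1 * (M%:R * b) ^+ 2.
  rewrite (eq_expect p (g := fun F => \sum_(S in ksubsets n t)
     \sum_(S' in ksubsets n t) (under S F)%:R * (under S' F)%:R)); last first.
    move=> F; rewrite inE => FD; rewrite /X num_undercoveredE// expr2.
    by rewrite big_distrlr.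
  rewrite expect_sum.
  (* The bound is spread over pairs: [b] pays for the diagonal, where the indicator is idempotent,
     and [c^-1 * b ^+ 2] for each other pair. *)
  have -> : M%:R * b + c^-1 * (M%:R * b) ^+ 2 =
      \sum_(S in ksubsets n t) (b + \sum_(S' in ksubsets n t) c^-1 * b ^+ 2).
    by rewrite !sumr_const card_ksubsets; move: M b c^-1 => x y z; ring.
  apply: ler_sum => S St; rewrite expect_sum (bigD1 S)//=.
  apply: lerD.
    rewrite -(expect_under St) le_eqVlt; apply/orP; left; apply/eqP.
    by apply: eq_expect => F _; case: under; rewrite ?mulr1 ?mulr0.
  rewrite [leRHS](bigD1 S)//= ler_wpDl ?mulr_ge0 ?invr_ge0 ?(ltW c0) ?sqr_ge0//.
  apply: ler_sum => S' /andP[S't S'S].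
  rewrite mulrC ler_pdivlMr// mulrC.
  apply: le_trans (expect_under2 St S't _); last by rewrite eq_sym.
  apply: ler_wpM2r => //; apply: expect_ge0 => // F; exact: mulr_ge0.
have := le_expect p01 (D := ksubsets n k)
  (f := fun F => (M%:R * b) ^+ 2 * (num_undercovered t l.+1 F == 0)%N%:R)
  (g := fun F => X F ^+ 2 + ((- (2 * (M%:R * b))) * X F + (M%:R * b) ^+ 2 * 1)).
rewrite expectD expectD !expectZ expect1 expect_num_undercovered => le.
apply: le_trans (le _) _.
  move=> F _; rewrite /X; case: num_undercovered => [|m] /=.
    by rewrite !mulr1 mulr0 !expr2 mulr0 !add0r.
  rewrite !mulr0 mulr1.
  have -> : m.+1%:R ^+ 2 + (- (2 * (M%:R * b)) * m.+1%:R + (M%:R * b) ^+ 2) =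
    (m.+1%:R - M%:R * b) ^+ 2 by ring.
  exact: sqr_ge0.
move: X2; set e := expect _ _ _; set m := M%:R * b; lra.
Qed.

End Undercovered.

From mathcomp Require Import all_classical all_reals all_analysis.
Import numFieldNormedType.Exports.

(** * Elementary bounds on binomial coefficients *)

Lemma leq_bin_expn (n m : nat) : ('C(n, m) <= n ^ m)%N.
Proof.
apply: (@leq_trans (n ^_ m)).
  by rewrite -bin_ffact leq_pmulr// fact_gt0.
elim: m n => [|m IHm] n //; rewrite ffactnS expnS leq_mul//.
apply: leq_trans (IHm n.-1) _.
by case: m {IHm} => // m; rewrite leq_exp2r// leq_pred.
Qed.

(** From [m * 'C(n, m) = n * 'C(n.-1, m.-1)]. This linear growth makes both [ln 'C(n, t)] and
    ['C(n - t, k - t)] unbounded. *)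
Lemma leq_mul_bin (n m : nat) : (0 < m <= n)%N -> (n <= m * 'C(n, m))%N.
Proof.
case: m => //= m mn; rewrite -mul_bin_diag leq_pmulr// bin_gt0; lia.
Qed.

Lemma leq_expn_ffact (n m : nat) : ((n - m) ^ m <= n ^_ m)%N.
Proof.
elim: m n => [|m IHm] [|n] //; first by rewrite sub0n exp0n.
rewrite ffactSS expnS subSS leq_mul ?IHm//; lia.
Qed.

(** * Exponential estimates for binomial tails and for the mean *)

Section Estimates.
Set Implicit Arguments.
Unset Strict Implicit.
Context {R : realType}.
Implicit Types (p x L r mu : R) (N l n : nat).

Lemma bernoulli_inequality x n : 0 <= x <= 1 -> 1 - n%:R * x <= (1 - x) ^+ n.
Proof.
move=> /andP[x0 x1]; elim: n => [|n IHn]; first by rewrite mul0r subr0.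
rewrite exprS; apply: le_trans (ler_wpM2l _ IHn); last by rewrite subr_ge0.
rewrite -natr1; have : 0 <= n%:R * x * x by rewrite !mulr_ge0.
lra.
Qed.

(** The generating function bound at [s = mu^-1], where [1 - p + p / mu <= expR (p / mu - p)] and
    the [N]-th power of the right-hand side is [expR (1 - mu)]. *)
Lemma binom_cdf_le_expR p N l : 0 <= p <= 1 -> 1 <= N%:R * p ->
  binom_cdf p N l <= expR 1 * (N%:R * p) ^+ l * expR (- (N%:R * p)).
Proof.
move=> p01; set mu := N%:R * p => mu1; have mu0 : 0 < mu by apply: lt_le_trans mu1.
have := @binom_cdf_chernoff _ p p01 N l mu^-1.
rewrite invr_gt0 mu0 invf_le1// mu1 => /(_ isT).
rewrite exprVn mulrC ler_pdivrMr ?exprn_gt0// => /le_trans; apply.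
rewrite mulrAC ler_wpM2r ?exprn_ge0 ?(ltW mu0)// -expRD.
have -> : 1 + - mu = (- p + p / mu) * N%:R.
  rewrite mulrDl mulrAC (mulrC p) divff ?gt_eqF//; rewrite /mu; ring.
rewrite expRM_natr; apply: lerXn2r; rewrite ?nnegrE ?expR_ge0//.
  case/andP: p01 => p0 p1; rewrite addr_ge0 ?subr_ge0// divr_ge0// ltW//.
by rewrite -addrA expR_ge1Dx.
Qed.

(** Only the term of index [j] is kept; since [N - j >= N / 2], its coefficient is at least
    [(N / 2) ^+ j / j!]. *)
Lemma binom_cdf_ge p N l j : 0 <= p <= 1 -> (j <= l)%N -> (l.*2 <= N)%N ->
  (N%:R * p / 2) ^+ j / (j`!)%:R * (1 - p) ^+ N <= binom_cdf p N l.
Proof.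
move=> p01 jl lN; have jl' : (j < l.+1)%N by [].
rewrite /binom_cdf (bigD1 (Ordinal jl')) //=.
apply: ler_wpDr; first by apply: sumr_ge0 => i _; exact: binom_mass_ge0.
case/andP: p01 => p0 p1; have q0 : 0 <= 1 - p by rewrite subr_ge0.
rewrite /binom_mass; apply: ler_pM.
- by rewrite divr_ge0// exprn_ge0// !mulr_ge0.
- exact: exprn_ge0.
- rewrite ler_pdivrMr ?ltr0n ?fact_gt0// [leRHS]mulrAC -natrM bin_ffact.
  rewrite (mulrAC _ p) exprMn ler_wpM2r ?exprn_ge0//.
  apply: (@le_trans _ _ ((N - j) ^ j)%N%:R); last by rewrite ler_nat leq_expn_ffact.
  rewrite natrX; apply: lerXn2r; rewrite ?nnegrE ?divr_ge0//.
  rewrite ler_pdivrMr// -natrM ler_nat; lia.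
- by apply: ler_wiXn2l; [|rewrite gerBl|exact: leq_subr].
Qed.

(** Since [1 + p <= expR p], one has [1 - p >= expR (- p) * (1 - p * p)]; Bernoulli's inequality
    handles the [N]-th power of the last factor. *)
Lemma onem_exp_ge_expR p N : 0 <= p <= 1 ->
  expR (- (N%:R * p)) * (1 - p * (N%:R * p)) <= (1 - p) ^+ N.
Proof.
move=> /andP[p0 p1].
have pp1 : 0 <= p * p <= 1 by rewrite mulr_ge0//= mulr_ile1.
apply: (@le_trans _ _ (expR (- (N%:R * p)) * (1 - p * p) ^+ N)).
  apply: ler_wpM2l; first exact: expR_ge0.
  by apply: le_trans (bernoulli_inequality N pp1); rewrite mulrCA.
rewrite -mulrN expRM_natl -exprMn; apply: lerXn2r; rewrite ?nnegrE ?subr_ge0//.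
  by rewrite mulr_ge0 ?expR_ge0// subr_ge0; case/andP: pp1.
have -> : 1 - p * p = (1 + p) * (1 - p) by ring.
rewrite mulrA ler_piMl ?subr_ge0// expRN mulrC ler_pdivrMr ?expR_gt0//.
by rewrite mul1r expR_ge1Dx.
Qed.

(** One term of the exponential series at [x / 2]. *)
Lemma exprn_le_expR_half x l : 0 <= x -> x ^+ l <= 2 ^+ l * (l`!)%:R * expR (x / 2).
Proof.
move=> x0; have f0 : 0 < (l`!)%:R :> R by rewrite ltr0n fact_gt0.
rewrite mulrAC -ler_pdivrMr//.
rewrite -ler_pdivrMl ?exprn_gt0// mulrA (mulrC _ (x ^+ l)) -expr_div_n.
have x20 : 0 <= x / 2 by rewrite divr_ge0.
case: l f0 => [|l] f0; first by rewrite divr1 (le_trans _ (expR_ge1Dx _)) ?lerDl.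
by apply: (le_trans _ (expR_ge1Dxn l x20)); rewrite lerDr.
Qed.

Lemma ln_le_id x : 0 < x -> ln x <= x.
Proof.
move=> x0; rewrite -{2}(lnK x0) (le_trans _ (expR_ge1Dx _))// lerDr//.
Qed.

(* With [L = ln 'C(n, t)] and [l = lambda - 1], the mean degree
   ['C(n - t, k - t) * p] of a [t]-set. *)
Definition mean_degree l L r : R := L + l%:R * ln L + r.

Definition upper_const l : R :=
  expR 1 * (2 ^+ l * (l`!)%:R * expR (l.+1%:R / 2)).

(** In [expR L * expR (- mu)] only [L ^- l * expR (- r)] survives, and [mu / L <= l.+1 + r]. The
    power of [l.+1 + r] costs a factor [expR (r / 2)], which leaves [expR (- (r / 2))]. *)
Lemma first_moment_bound l L r : 1 <= L -> 0 <= r ->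
  expR L * (expR 1 * mean_degree l L r ^+ l * expR (- mean_degree l L r)) <=
  upper_const l * expR (- (r / 2)).
Proof.
move=> L1 r0; set mu := mean_degree l L r; have L0 : 0 < L by apply: lt_le_trans L1.
have lnL0 : 0 <= ln L by rewrite ln_ge0.
have mu0 : 0 <= mu by rewrite !addr_ge0 ?mulr_ge0 ?(ltW L0).
have x0 : 0 <= l.+1%:R + r by rewrite addr_ge0.
have muL : mu <= L * (l.+1%:R + r).
  have : l%:R * ln L <= l%:R * L by rewrite ler_wpM2l// ln_le_id.
  have : r <= L * r by rewrite ler_peMl.
  rewrite /mu /mean_degree -natr1; lra.
have -> : expR L * (expR 1 * mu ^+ l * expR (- mu)) =
    expR 1 * ((mu / L) ^+ l * expR (- r)).
  have -> : - mu = - L + - (l%:R * ln L) - r by rewrite /mu /mean_degree; ring.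
  rewrite !expRD !expRN expRM_natl lnK// expr_div_n.
  have := expR_gt0 L; have := exprn_gt0 l L0; have := expR_gt0 r.
  move: (expR L) (expR r) (expR 1) => a c e c0 d0 a0; field.
  by rewrite !gt_eqF.
rewrite /upper_const -mulrA ler_wpM2l ?expR_ge0//.
have -> : - (r / 2) = r / 2 - r by field.
rewrite expRD mulrA ler_wpM2r ?expR_ge0//.
rewrite -mulrA -expRD -mulrDl; apply: le_trans (exprn_le_expR_half l x0).
apply: lerXn2r; rewrite ?nnegrE ?divr_ge0 ?(ltW L0)//.
by rewrite ler_pdivrMr// mulrC.
Qed.

Lemma mean_degree_ge1 l L r : 1 <= L -> 0 <= r -> 1 <= mean_degree l L r.
Proof.
move=> L1 r0; have : 0 <= l%:R * ln L by rewrite mulr_ge0// ln_ge0.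
rewrite /mean_degree; lra.
Qed.

Lemma mean_degree_le l L r : 1 <= L -> r <= 0 -> mean_degree l L r <= l.+1%:R * L.
Proof.
move=> L1 r0; have : l%:R * ln L <= l%:R * L.
  by rewrite ler_wpM2l// ln_le_id// (lt_le_trans _ L1).
rewrite /mean_degree -natr1; lra.
Qed.

(** The 2 comes from [(1 - p) ^+ N >= expR (- mu) / 2], the rest from [(mu / 2) ^+ l / l!] with
    [mu >= L / 2]. *)
Definition lower_const l : R := 2 * 4 ^+ l * (l`!)%:R.

Lemma lower_const_ge2 l : 2 <= lower_const l.
Proof.
rewrite /lower_const -mulrA ler_peMr// -natrX -natrM ler1n muln_gt0 expn_gt0.
by rewrite fact_gt0.
Qed.

(* If the mean degree is at most [L / 2], already [P(Bin(N, p) = 0)] is large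
   enough; otherwise [P(Bin(N, p) = l)] is. *)
Lemma second_moment_bound p N l L r : 0 <= p <= 1 -> (l.*2 <= N)%N -> 1 <= L ->
  N%:R * p = mean_degree l L r -> p * (N%:R * p) <= 1 / 2 ->
  0 < binom_cdf p N l /\
  (expR L * binom_cdf p N l)^-1 <= lower_const l * (expR (- (L / 2)) + expR r).
Proof.
move=> p01 lN L1; set mu := N%:R * p => muE pmu.
have L0 : 0 < L by apply: lt_le_trans L1.
have q_ge : expR (- mu) / 2 <= (1 - p) ^+ N.
  apply: le_trans (onem_exp_ge_expR N p01).
  rewrite ler_wpM2l ?expR_ge0// -/mu; lra.
have c2 := lower_const_ge2 l.
have c0 : 0 < lower_const l by apply: lt_le_trans c2.
suff [y [y0 by_ yle]] : exists y : R, [/\ 0 < y, y <= expR L * binom_cdf p N l &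
    y^-1 <= lower_const l * (expR (- (L / 2)) + expR r)].
  have bL0 := lt_le_trans y0 by_.
  split; first by rewrite pmulr_rgt0 ?expR_gt0 in bL0.
  by apply: (le_trans _ yle); rewrite lef_pV2.
case: (lerP mu (L / 2)) => muL.
  exists (expR (L / 2) / 2); split; first by rewrite divr_gt0 ?expR_gt0.
    have := @binom_cdf_ge p N l 0%N p01 isT lN.
    rewrite expr0 divr1 mul1r => /(le_trans q_ge).
    move=> /(ler_wpM2l (expR_ge0 L)); apply: le_trans.
    rewrite mulrA -expRD ler_wpM2r// ler_expR; lra.
  rewrite invf_div expRN mulrC; set e := (expR _)^-1.
  have e0 : 0 < e by rewrite invr_gt0 expR_gt0.
  rewrite mulrC; apply: (@le_trans _ _ (lower_const l * e)).
    by rewrite ler_wpM2r// ltW.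
  by rewrite ler_wpM2l ?(ltW c0)// lerDl expR_ge0.
(* In the term of index [l], the power [L ^+ l] cancels the factor [expR (- (l * ln L))] of
   [expR (- mu)]. *)
exists ((lower_const l)^-1 * expR (- r)); split.
- by rewrite mulr_gt0 ?invr_gt0 ?expR_gt0.
- have := @binom_cdf_ge p N l l p01 (leqnn l) lN.
  move=> /(ler_wpM2l (expR_ge0 L)); apply: le_trans.
  have f0 : 0 < (l`!)%:R :> R by rewrite ltr0n fact_gt0.
  apply: (@le_trans _ _ (expR L * ((L / 4) ^+ l / (l`!)%:R * (expR (- mu) / 2)))).
    have -> : - mu = - L + - (l%:R * ln L) - r.
      by rewrite muE /mean_degree; ring.
    rewrite !expRD !expRN expRM_natl lnK// expr_div_n /lower_const.
    have := expR_gt0 L; have := exprn_gt0 l L0; have := expR_gt0 r.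
    have : 0 < 4 ^+ l :> R by rewrite exprn_gt0.
    move: f0 (4 ^+ l) (L ^+ l) (expR L) (expR r) => f0 z d a c z0 c0' d0 a0.
    by rewrite le_eqVlt; apply/orP; left; apply/eqP; field; rewrite !gt_eqF.
  rewrite ler_wpM2l ?expR_ge0//; apply: ler_pM => //.
    by rewrite divr_ge0// exprn_ge0// divr_ge0// ltW.
  rewrite ler_wpM2r ?invr_ge0//; apply: lerXn2r; rewrite ?nnegrE -/mu; lra.
- rewrite invfM invrK expRN invrK ler_wpM2l ?(ltW c0)// lerDr expR_ge0//.
Qed.

End Estimates.

(** * The law of the random family *)

Section Law.
Set Implicit Arguments.
Unset Strict Implicit.
Local Open Scope classical_set_scope.
Variables (d : measure_display) (T : measurableType d) (R : realType).
Variables (P : probability T R) (n k : nat) (p : R).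
Variable C : T -> {set {set 'I_n}}.
Hypothesis hC : binomial_random_family P k p C.
Implicit Types (B E F : {set {set 'I_n}}).

(** Independence is given for inclusions only; prescribing exclusions [E] as well leads from there
    to the probability of each single family. *)
Let cylinder B E : set T := [set w | (B \subset C w) && (C w :&: E == finset.set0)%SET].

Lemma inclusion_prob_itv : (k <= n)%N -> 0 <= p <= 1.
Proof.
case: hC => _ mC PC _ kn.
have : (0 < #|ksubsets n k|)%N by rewrite card_ksubsets bin_gt0.
case/card_gt0P => A Ak; rewrite -2!lee_fin -(PC A Ak).
by rewrite measure_ge0 probability_le1//; exact: mC.
Qed.

(* Passing from [E] to [a |: E] removes from the cylinder the one where [a] is
   moved to [B]. *)
Let law_cylinder B E : B \subset ksubsets n k -> E \subset ksubsets n k ->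
  (B :&: E)%SET = finset.set0 ->
  measurable (cylinder B E) /\
  P (cylinder B E) = (p ^+ #|B| * (1 - p) ^+ #|E|)%:E.
Proof.
case: hC => _ mC PC indC.
have [m] := ubnP #|E|; elim: m B E => // m IHm B E Em BD ED BE0.
have [->|[a aE]] := set_0Vmem E.
  have -> : cylinder B finset.set0 = \bigcap_(A in [set` B]) [set w | A \in C w].
    apply/seteqP; split => w /=; rewrite /cylinder/= finset.setI0 eqxx andbT.
      by move=> /fintype.subsetP BC A /= /BC.
    by move=> BC; apply/fintype.subsetP => A AB; exact: BC.
  split.
    apply: fin_bigcap_measurable; first exact: finite_finset.
    by move=> A AB; apply: mC; exact: (fintype.subsetP BD).
  rewrite cards0 mulr1 indC// (eq_bigr (fun=> p%:E)).
    by rewrite prodEFin prodr_const.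
  by move=> A AB; apply: PC; exact: (fintype.subsetP BD).
have aB : a \notin B.
  by apply/negP => aB; have := finset.in_set0 a; rewrite -BE0 inE aB aE.
have cE := cardsD1 a E; rewrite aE add1n in cE.
have E'm : (#|E :\ a| < m)%N by rewrite cE in Em.
have E'D : (E :\ a)%SET \subset ksubsets n k.
  exact: fintype.subset_trans (finset.subD1set E a) ED.
have aBD : (a |: B)%SET \subset ksubsets n k.
  by rewrite finset.subUset BD andbT finset.sub1set; exact: (fintype.subsetP ED).
have BE'0 : (B :&: (E :\ a))%SET = finset.set0.
  by rewrite finset.setIDA BE0 finset.set0D.
have aBE'0 : ((a |: B) :&: (E :\ a))%SET = finset.set0.
  rewrite finset.setIUl BE'0 finset.setU0; apply/finset.setP => x.
  by rewrite !inE; case: eqP.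
have [m1 P1] := IHm _ _ E'm BD E'D BE'0.
have [m2 P2] := IHm _ _ E'm aBD E'D aBE'0.
have cylE : cylinder B E = cylinder B (E :\ a)%SET `\` cylinder (a |: B)%SET (E :\ a)%SET.
  have CE w : (C w :&: E == finset.set0)%SET =
      (a \notin C w) && (C w :&: (E :\ a) == finset.set0)%SET.
    rewrite -{1}(finset.setD1K aE) finset.setIUr finset.setU_eq0; congr andb.
    by rewrite finset.setI_eq0 disjoint_sym finset.disjoints1.
  apply/seteqP; split => w; rewrite /cylinder/= CE finset.subUset finset.sub1set.
    by move=> /and3P[-> /negPf-> ->].
  by move=> [/andP[-> ->]] /negP; rewrite !andbT.
have sub21 : cylinder (a |: B)%SET (E :\ a)%SET `<=` cylinder B (E :\ a)%SET.
  by move=> w; rewrite /cylinder/= finset.subUset -andbA => /andP[_].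
rewrite cylE; split; first exact: measurableD.
rewrite measureD//; last by rewrite [X in (X < _)%E]P1 ltry.
rewrite setIidr// [X in (X - _)%E]P1 [X in (_ - X)%E]P2 -EFinB; congr (_%:E).
rewrite cardsU1 aB cE; move: #|B| #|(E :\ a)%SET| => b e.
by rewrite exprD exprS; ring.
Qed.

Let law_point F : F \subset ksubsets n k ->
  measurable [set w | C w = F] /\ P [set w | C w = F] = (weight p (ksubsets n k) F)%:E.
Proof.
case: (hC) => CD _ _ _ FD.
have -> : [set w | C w = F] = cylinder F (ksubsets n k :\: F)%SET.
  apply/seteqP; split => w; rewrite /cylinder/=.
    move=> ->; rewrite fintype.subxx/= finset.setIDA finset.setD_eq0.
    exact: finset.subsetIl.
  move=> /andP[FC]; rewrite finset.setIDA finset.setD_eq0 (finset.setIidPl (CD w)) => CF.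
  by apply/eqP; rewrite finset.eqEsubset CF.
apply: law_cylinder => //; first exact: finset.subsetDl.
apply/finset.setP => x; rewrite !inE; by case: (x \in F).
Qed.

(** The bridge from [P] to finite sums: the event is a finite disjoint union of events [C w = F],
    each of them a cylinder with [E] the complement of [F]. *)
Lemma law_binomial_family (Q : pred {set {set 'I_n}}) :
  P [set w | Q (C w)] = (expect p (ksubsets n k) (fun F => (Q F)%:R))%:E.
Proof.
case: (hC) => CD _ _ _.
have law_seq (s : seq {set {set 'I_n}}) : uniq s ->
    all (fun F => F \subset ksubsets n k) s ->
    measurable [set w | C w \in s] /\
    P [set w | C w \in s] = (\sum_(F <- s) weight p (ksubsets n k) F)%:E.
  elim: s => [|F s IHs] /=.
    move=> _ _; rewrite big_nil (_ : [set w | _] = set0) ?measure0//.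
    by apply/seteqP; split.
  move=> /andP[Fs us] /andP[FD sD]; have [ms Ps] := IHs us sD.
  have [mF PF] := law_point FD.
  have -> : [set w | C w \in F :: s] = [set w | C w = F] `|` [set w | C w \in s].
    apply/seteqP; split => w /=; rewrite inE.
      by move=> /orP[/eqP|]; [left|right].
    by move=> [->|->]; rewrite ?eqxx ?orbT.
  split; first exact: measurableU.
  rewrite measureU//; last first.
    by apply/seteqP; split => w //= -[->] Fs'; rewrite Fs' in Fs.
  by rewrite [X in (X + _)%E = _]PF [X in (_ + X)%E = _]Ps big_cons -EFinD.
pose s := enum [pred F : {set {set 'I_n}} | (F \subset ksubsets n k) && Q F].
have -> : [set w | Q (C w)] = [set w | C w \in s].
  by apply/seteqP; split => w /=; rewrite mem_enum inE CD.
have [|_ ->] := law_seq s (enum_uniq _).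
  by apply/allP => F; rewrite mem_enum inE => /andP[].
rewrite big_enum/= /expect; congr (_%:E).
rewrite big_mkcondr; apply: eq_bigr => F _.
by case: (Q F); rewrite ?mulr1 ?mulr0.
Qed.

End Law.

(** * Explicit bounds on the probability that no set is undercovered *)

Section ZeroProbability.
Set Implicit Arguments.
Unset Strict Implicit.
Variables (R : realType) (t k l : nat).
Hypotheses (t1 : (1 <= t)%N) (tk : (t < k)%N).
Implicit Types (n : nat) (r : R).

Definition log_bin n : R := ln 'C(n, t)%:R.

Definition zero_prob n r : R :=
  expect (inclusion_prob t k l.+1 n r) (ksubsets n k)
    (fun F => (num_undercovered t l.+1 F == 0)%N%:R).

(* Bounds both ['C(n - t - 1, k - t - 1) * p] and [p] times the mean degree. *)
Definition overlap n : R :=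
  (l.+1%:R * log_bin n) ^+ 2 * (k - t)%:R / (n - t)%:R.

Lemma mean_degreeE n r : (k <= n)%N ->
  'C(n - t, k - t)%:R * inclusion_prob t k l.+1 n r = mean_degree l (log_bin n) r.
Proof.
move=> kn; rewrite /inclusion_prob mulVKf ?pnatr_eq0 -?lt0n ?bin_gt0 ?leq_sub2r//.
by rewrite -natr1 addrK.
Qed.

Lemma expR_log_bin n : (k <= n)%N -> expR (log_bin n) = 'C(n, t)%:R.
Proof.
by move=> kn; rewrite lnK// posrE ltr0n bin_gt0 (leq_trans (ltnW tk)).
Qed.

Lemma zero_prob_itv n r : 0 <= inclusion_prob t k l.+1 n r <= 1 ->
  0 <= zero_prob n r <= 1.
Proof.
move=> p01; rewrite expect_ge0//= -[leRHS](expect1 (inclusion_prob t k l.+1 n r)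
  (ksubsets n k)).
by apply: le_expect => // F _; case: eqP.
Qed.

Lemma zero_prob_ge n r : (k <= n)%N ->
  0 <= inclusion_prob t k l.+1 n r <= 1 -> 1 <= log_bin n -> 0 <= r ->
  1 - upper_const l * expR (- (r / 2)) <= zero_prob n r.
Proof.
move=> kn p01 L1 r0; apply: le_trans (first_moment n l p01 tk).
rewrite lerB// -(expR_log_bin kn).
apply: le_trans (first_moment_bound l L1 r0).
rewrite ler_wpM2l ?expR_ge0// -(mean_degreeE r kn).
by apply: binom_cdf_le_expR => //; rewrite mean_degreeE// mean_degree_ge1.
Qed.

(** The second moment bound with [c = (1 - del) ^+ 2], divided by the squared mean [m ^+ 2], gives
    [m^-1 + (c^-1 - 1)]. *)
Lemma zero_prob_le n r : (k <= n)%N ->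
  0 <= inclusion_prob t k l.+1 n r <= 1 -> 1 <= log_bin n -> r <= 0 ->
  (l.*2 <= 'C(n - t, k - t))%N -> overlap n <= 1 / 2 ->
  zero_prob n r <=
  lower_const l * (expR (- (log_bin n / 2)) + expR r) + 6 * overlap n.
Proof.
move=> kn p01 L1 r0 lN; set p := inclusion_prob _ _ _ _ _ in p01 *.
have tn : (t < n)%N by apply: leq_trans kn.
set N := 'C(n - t, k - t); set N' := 'C(n - t.+1, k - t.+1).
set del := overlap n => del2.
have muE : N%:R * p = mean_degree l (log_bin n) r by rewrite mean_degreeE.
have mule := mean_degree_le l L1 r0; rewrite -muE in mule.
set y := l.+1%:R * log_bin n in mule.
have y1 : 1 <= y by rewrite mulr_ege1// ler1n.
case/andP: (p01) => p0 p1.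
have mu0 : 0 <= N%:R * p by rewrite mulr_ge0.
have nt0 : 0 < (n - t)%:R :> R by rewrite ltr0n subn_gt0.
(* The absorption identity [(n - t) * N' = (k - t) * N]. *)
have N'p : N'%:R * p = N%:R * p * (k - t)%:R / (n - t)%:R.
  apply: (canRL (mulfK (lt0r_neq0 nt0))).
  rewrite mulrAC -natrM (mulrAC _ p) -natrM; congr (_%:R * _).
  have kt : (k - t = (k - t.+1).+1)%N by lia.
  rewrite /N /N' kt.
  by rewrite [RHS]mulnC -mul_bin_diag mulnC (subnS n t).
set w := (k - t)%:R / (n - t)%:R : R.
have w0 : 0 <= w by rewrite divr_ge0.
rewrite -mulrA -/w in N'p.
have delE : del = y ^+ 2 * w by rewrite /del /overlap -/y mulrA.
(* The square in [overlap] serves twice: [N' * p <= y * w <= y ^+ 2 * w] as [y >= 1], and below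
   [p * mu <= N' * p * mu = mu ^+ 2 * w]. *)
have N'p_le : N'%:R * p <= del.
  rewrite N'p delE ler_wpM2r// (le_trans mule)// expr2.
  by rewrite ler_peMr// (le_trans _ y1).
have N'1 : 1 <= N'%:R :> R by rewrite ler1n bin_gt0 leq_sub2r.
have pmu : p * (N%:R * p) <= del.
  apply: (@le_trans _ _ (N'%:R * p * (N%:R * p))).
    by rewrite ler_wpM2r// ler_peMl.
  by rewrite N'p mulrAC delE ler_wpM2r// expr2 ler_pM.
have del0 : 0 <= del by apply: le_trans N'p_le; rewrite mulr_ge0.
have [b0 m_le] := second_moment_bound p01 lN L1 muE (le_trans pmu del2).
rewrite (expR_log_bin kn) in m_le.
have c_le : 0 < (1 - del) ^+ 2 <= (1 - p) ^+ N'.*2.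
  rewrite exprn_gt0; last by rewrite subr_gt0; lra.
  rewrite -muln2 exprM lerXn2r ?nnegrE ?exprn_ge0 ?subr_ge0//; first by lra.
  apply: le_trans (bernoulli_inequality N' p01); lra.
have := second_moment l p01 tk c_le.
set m := 'C(n, t)%:R * _ in m_le *.
have m0 : 0 < m.
  by rewrite mulr_gt0// -(expR_log_bin kn) expR_gt0.
rewrite -/(zero_prob n r) => m_zero.
have : zero_prob n r <= m^-1 + (((1 - del) ^+ 2)^-1 - 1).
  rewrite -(ler_pM2l (exprn_gt0 2 m0)); apply: le_trans m_zero _.
  rewrite mulrDr expr2 -mulrA divff ?lt0r_neq0// mulr1 -expr2.
  by rewrite [X in _ + X <= _]mulrC.
move=> /le_trans; apply; apply: lerD => //.
(* The constant 6 makes [c^-1 - 1 <= 6 * del] an equality at [del = 1 / 2]. *)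
rewrite lerBlDr -div1r ler_pdivrMr; last by case/andP: c_le.
rewrite -subr_ge0.
have -> : (6 * del + 1) * (1 - del) ^+ 2 - 1 = del * ((1 - 2 * del) * (4 - 3 * del)).
  by ring.
by rewrite !mulr_ge0 //; lra.
Qed.

Local Open Scope classical_set_scope.

Lemma log_bin_cvgy : log_bin n @[n --> \oo] --> +oo.
Proof.
apply/cvgryPge => A; near=> n.
have tn : (0 < t <= n)%N by rewrite t1; near: n; exact: nbhs_infty_ge.
rewrite -[A]expRK ler_ln ?posrE ?expR_gt0 ?ltr0n ?bin_gt0//; last by case/andP: tn.
have t0 : 0 < t%:R :> R by rewrite ltr0n.
rewrite -(ler_pM2l t0) -natrM; apply: (@le_trans _ _ n%:R); last first.
  by rewrite ler_nat; exact: leq_mul_bin.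
by near: n; exact: nbhs_infty_ger.
Unshelve. all: by end_near. Qed.

Lemma ln_nat_cvgy : ln n%:R @[n --> \oo] --> (+oo : set_system R).
Proof.
apply/cvgryPge => A; near=> n.
have nA : expR A <= n%:R by near: n; exact: nbhs_infty_ger.
by rewrite -[A]expRK ler_ln ?posrE ?expR_gt0// (lt_le_trans _ nA) ?expR_gt0.
Unshelve. all: by end_near. Qed.

(** Since [ln n ^+ 3 <= 48 * n] with [48 = 2 ^ 3 * 3!], the quotient of [ln n ^+ 2] by [n] is
    [O(1 / ln n)]; replacing [n - t] by [n / 2] doubles 48 to 96. *)
Lemma overlap_le n : (t.*2 < n)%N ->
  overlap n <= (l.+1%:R * t%:R) ^+ 2 * (k - t)%:R * 96 * (ln n%:R)^-1.
Proof.
move=> n2t.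
have n1 : 1 < n%:R :> R by rewrite ltr1n; lia.
have n0 : 0 < n%:R :> R by apply: lt_trans n1.
have ln0 : 0 < ln n%:R :> R by rewrite ln_gt0.
have L0 : 0 <= log_bin n by rewrite ln_ge0// ler1n bin_gt0; lia.
have L_le : log_bin n <= t%:R * ln n%:R.
  rewrite mulr_natl -lnXn// -natrX ler_ln ?posrE ?ltr0n ?ler_nat ?leq_bin_expn//.
    by rewrite bin_gt0; lia.
  by rewrite expn_gt0; apply/orP; left; lia.
have ln3 : (ln n%:R) ^+ 3 <= 48 * n%:R :> R.
  apply: (le_trans (exprn_le_expR_half 3 (ltW ln0))).
  rewrite -natrX -natrM ler_wpM2l// -[leRHS]lnK// ler_expR; lra.
have nt : n%:R <= 2 * (n - t)%:R :> R by rewrite -natrM ler_nat; lia.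
have nt0 : 0 < (n - t)%:R :> R by rewrite ltr0n; lia.
rewrite /overlap ler_pdivrMr//.
apply: (@le_trans _ _ ((l.+1%:R * (t%:R * ln n%:R)) ^+ 2 * (k - t)%:R)).
  rewrite ler_wpM2r// lerXn2r ?nnegrE ?mulr_ge0 ?(ltW ln0)// ler_wpM2l//.
have -> : (l.+1%:R * (t%:R * ln n%:R)) ^+ 2 * (k - t)%:R =
    (l.+1%:R * t%:R) ^+ 2 * (k - t)%:R * ln n%:R ^+ 2 :> R by ring.
have a0 : 0 <= (l.+1%:R * t%:R) ^+ 2 * (k - t)%:R :> R by rewrite mulr_ge0 ?sqr_ge0.
move: (_ ^+ 2 * _) a0 => a a0; rewrite -!mulrA ler_wpM2l//.
rewrite mulrCA ler_pdivlMl// -exprS; lra.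
Qed.

Lemma overlap_cvg0 : overlap n @[n --> \oo] --> (0 : R).
Proof.
pose K : R := (l.+1%:R * t%:R) ^+ 2 * (k - t)%:R * 96.
have Kcvg : K * (ln n%:R)^-1 @[n --> \oo] --> (0 : R).
  rewrite -(mulr0 K); apply: cvgMr.
  apply/gtr0_cvgV0; last exact: ln_nat_cvgy.
  by move/cvgryPgt : ln_nat_cvgy; exact.
apply: squeeze_cvgr Kcvg; last exact: cvg_cst.
near=> n; rewrite overlap_le ?andbT; last by near: n; exact: nbhs_infty_gt.
by rewrite /overlap divr_ge0// mulr_ge0// sqr_ge0.
Unshelve. all: by end_near. Qed.

End ZeroProbability.

(** * Passage to the limit by squeezing *)

Local Open Scope classical_set_scope.
Local Open Scope ring_scope.

Theorem theorem2p4 (R : realType) (t k lambda : nat)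
    (ht : (1 <= t)%N) (htk : (t < k)%N) (hlambda : (1 <= lambda)%N)
    (r : nat -> R)
    (d : nat -> measure_display) (Omega : forall n, measurableType (d n))
    (P : forall n, probability (Omega n) R)
    (C : forall n, Omega n -> {set {set 'I_n}})
    (hC : \forall n \near \oo,
       binomial_random_family (P n) k (inclusion_prob t k lambda n (r n)) (C n)) :
  let X := fun n (w : Omega n) => num_undercovered t lambda (C n w) in
  (r n @[n --> \oo] --> +oo ->
     P n [set w | X n w = 0%N] @[n --> \oo] --> 1%E) /\
  (r n @[n --> \oo] --> -oo ->
     P n [set w | X n w = 0%N] @[n --> \oo] --> 0%E).
Proof.
move=> X; case: lambda hlambda hC @X => // l _ hC X.
have PE : \forall n \near \oo,
    P n [set w | X n w = 0%N] = (zero_prob t k l n (r n))%:E.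
  near=> n; have hCn : binomial_random_family (P n) k
    (inclusion_prob t k l.+1 n (r n)) (C n) by near: n; exact: hC.
  rewrite -(law_binomial_family hCn (fun F => num_undercovered t l.+1 F == 0%N)).
  by congr (P n _); apply/seteqP; split => w /eqP.
have p01 : \forall n \near \oo, 0 <= inclusion_prob t k l.+1 n (r n) <= 1.
  near=> n; have hCn : binomial_random_family (P n) k
    (inclusion_prob t k l.+1 n (r n)) (C n) by near: n; exact: hC.
  by apply: (inclusion_prob_itv hCn); near: n; exact: nbhs_infty_ge.
have LE : \forall n \near \oo, 1 <= log_bin R t n.
  by move/cvgryPge : (@log_bin_cvgy R _ ht); exact.
have N_large : \forall n \near \oo, (l.*2 <= 'C(n - t, k - t))%N.
  near=> n.
  (* So large an [n] gives [(k - t) * l.*2 <= n - t <= (k - t) * 'C(n - t, k - t)]. *)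
  have nt : (k + (k - t) * l.*2 + t <= n)%N by near: n; exact: nbhs_infty_ge.
  have kt : (0 < k - t)%N by rewrite subn_gt0.
  rewrite -(leq_pmul2l kt); apply: (@leq_trans (n - t)); first lia.
  by apply: leq_mul_bin; lia.
have expR_cvg0 (u : nat -> R) :
    u n @[n --> \oo] --> +oo -> expR (- u n) @[n --> \oo] --> 0.
  by move=> uy; exact: cvg_comp uy (@cvgr_expR R).
have expR_half_cvg0 (u : nat -> R) :
    u n @[n --> \oo] --> +oo -> expR (- (u n / 2)) @[n --> \oo] --> 0.
  move=> uy; apply: (expR_cvg0 (fun n => u n / 2)).
  have half0 : 0 < 2^-1 :> R by rewrite invr_gt0.
  exact: cvg_comp uy (gt0_cvgMly half0 cvg_id).
split=> ry.
- have lo : (1 - upper_const l * expR (- (r n / 2)))%:E @[n --> \oo] --> 1%:E.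
    apply: cvg_EFin; first exact: nearW.
    rewrite -[X in _ --> X]subr0 -[X in _ - X](mulr0 (upper_const l : R)).
    apply: cvgB; first exact: cvg_cst.
    by apply: cvgMr; exact: expR_half_cvg0.
  apply: (squeeze_cvge _ lo (cvg_cst _)).
  near=> n; rewrite (_ : P n _ = (zero_prob t k l n (r n))%:E); last first.
    by near: n; exact: PE.
  apply/andP; split.
    rewrite lee_fin; apply: zero_prob_ge => //.
    - by near: n; exact: nbhs_infty_ge.
    - by near: n; exact: p01.
    - by near: n; exact: LE.
    - by near: n; move/cvgryPge : ry; exact.
  rewrite lee_fin; suff /andP[] : 0 <= zero_prob t k l n (r n) <= 1 by [].
  by apply: zero_prob_itv; near: n; exact: p01.
have hi : (lower_const l * (expR (- (log_bin R t n / 2)) + expR (r n)) +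
    6 * overlap R t k l n)%:E @[n --> \oo] --> 0%:E.
  apply: cvg_EFin; first exact: nearW.
  rewrite -[X in _ --> X]addr0; apply: cvgD.
    rewrite -[X in _ --> X](mulr0 (lower_const l : R)); apply: cvgMr.
    rewrite -[X in _ --> X]addr0; apply: cvgD.
      by apply: expR_half_cvg0; exact: log_bin_cvgy.
    have nry : - r n @[n --> \oo] --> +oo by apply/cvgNry.
    by have := expR_cvg0 _ nry; under eq_fun do rewrite opprK.
  rewrite -[X in _ --> X](mulr0 6); apply: cvgMr; exact: overlap_cvg0 l ht htk.
have half0 : 0 < 1 / 2 :> R by [].
have ov_le : \forall n \near \oo, overlap R t k l n <= 1 / 2.
  exact: (cvgr_le _ (overlap_cvg0 l ht htk)).
apply: (squeeze_cvge _ (cvg_cst _) hi).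
near=> n; rewrite measure_ge0/=.
rewrite (_ : P n _ = (zero_prob t k l n (r n))%:E); last by near: n; exact: PE.
rewrite lee_fin; apply: zero_prob_le => //.
- by near: n; exact: nbhs_infty_ge.
- by near: n; exact: p01.
- by near: n; exact: LE.
- by near: n; move/cvgrNyPle : ry; exact.
- by near: n; exact: N_large.
- by near: n; exact: ov_le.
Unshelve. all: by end_near. Qed.
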